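(* For any $d\in\mathbb{N}_0$, $$t^{\star}(2,\{1\}^d,2)=-\frac{2}{\pi}\sum_{r=1}^{d+1}2^r\sum_{\substack{s_1+\cdots+s_r=d+1\\ s_1,\ldots,s_r\geq1}}t(s_1+2,s_2,\ldots,s_{r-1},\overline{s_r+2}),$$ where for $r=1$ the inner sum is the single value $t(\overline{d+5})$.
   Context: $t^{\star}(\boldsymbol{s})=\sum_{k_1\geq\cdots\geq k_r\geq1}\prod_{j}(2k_j-1)^{-s_j}$ for an index with $s_1>1$; $\{1\}^d$ is $1$ repeated $d$ times. Alternating multiple $t$-values: $t(\boldsymbol{s};\boldsymbol{\sigma})=\sum_{k_1>\cdots>k_r\geq1}\prod_{j}\frac{\sigma_j^{k_j}}{(2k_j-1)^{s_j}}$, where a bar over $s_j$ means $\sigma_j=-1$ and no bar means $\sigma_j=1$ (here only the last argument carries sign $-1$). *)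

(* Defs.v *)
From Stdlib Require Import Reals List.
From Coquelicot Require Import Coquelicot.
Import ListNotations.
Open Scope R_scope.

Fixpoint tstar_trunc (s : list nat) (N : nat) : R :=
  match s with
  | [] => 1
  | a :: s' =>
      fold_right Rplus 0
        (map (fun k => / (2 * INR k - 1) ^ a * tstar_trunc s' k) (List.seq 1 N))
  end.

Definition tstar (s : list nat) : R := real (Lim_seq (fun N => tstar_trunc s N)).

Fixpoint talt_trunc (s : list (nat * R)) (N : nat) : R :=
  match s with
  | [] => 1
  | (a, sg) :: s' =>
      fold_right Rplus 0
        (map (fun k => sg ^ k / (2 * INR k - 1) ^ a * talt_trunc s' (k - 1))
             (List.seq 1 N))
  end.

Definition talt (s : list (nat * R)) : R := real (Lim_seq (fun N => talt_trunc s N)).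

Fixpoint compositions (n r : nat) : list (list nat) :=
  match r with
  | O => match n with O => [[]] | _ => [] end
  | S r' => flat_map (fun a => map (cons a) (compositions (n - a) r'))
                     (List.seq 1 n)
  end.

Definition bump_first (l : list nat) : list nat :=
  match l with [] => [] | a :: l' => (a + 2)%nat :: l' end.
Definition bump_last (l : list nat) : list nat := rev (bump_first (rev l)).

(* For a composition (s1,...,sr): the argument list
   (s1+2, s2, ..., s_{r-1}, \bar{s_r+2}), with only the last sign equal to -1.
   For r = 1 this is (\bar{s1+4}). *)
Definition t_args (c : list nat) : list (nat * R) :=
  let e := bump_last (bump_first c) in
  combine e (repeat 1 (length e - 1) ++ [-1]).

(* Main.v *)
Require Import Defs.
From Stdlib Require Import Reals List Lra Lia.
From Coquelicot Require Import Coquelicot.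
Import ListNotations.
Open Scope R_scope.

(* Write [a_k = 1 / (2 k - 1)] and define sequences [dual d] by
   [dual 0 k = 2 (-1)^k a_k^2] and [dual (d+1) k = P k + P (k-1)], where [P] is
   the partial sum of [a_j dual d j].  Peeling the first part off a composition
   shows that the truncated right-hand side is [sum_{k <= N} a_k^3 dual d k].

   On the other side let [c_{n,k} = prod_{j <> k, j <= n} a_k^2 / (a_k^2 - a_j^2)].
   Two facts drive the proof: [c_{n,k} - c_{n-1,k} = c_{n,k} a_n^2 / a_k^2], so
   that prepending a [2] to a star sum multiplies the transformed sequence by
   [a_k^2], and the hypergeometric ratio [c_{n,k+1} / c_{n,k}], which makes the
   effect of prepending a [1] telescope.  Hence the truncation of
   [t*(2,{1}^d,2)] at [N] equals [(1/2) sum_k (-1)^k c_{N,k} a_k^2 dual d k].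
   Since [sum_k c_{n,k} = 1], Leibniz' series for pi gives
   [c_{N,k} -> (4/pi) (-1)^(k-1) a_k], and dominated convergence concludes. *)

(** * Finite sums over [1..N] *)

Definition psum (f : nat -> R) (N : nat) : R :=
  fold_right Rplus 0 (map f (List.seq 1 N)).

Lemma fold_right_Rplus_app (l l' : list R) :
  fold_right Rplus 0 (l ++ l') = fold_right Rplus 0 l + fold_right Rplus 0 l'.
Proof. induction l as [|x l IH]; simpl; [ring | rewrite IH; ring]. Qed.

Lemma psum_0 f : psum f 0 = 0.
Proof. reflexivity. Qed.

Lemma psum_S f N : psum f (S N) = psum f N + f (S N).
Proof.
  unfold psum. rewrite seq_S, map_app, fold_right_Rplus_app. simpl. ring.
Qed.

Lemma psum_ext f g N :
  (forall k, (1 <= k <= N)%nat -> f k = g k) -> psum f N = psum g N.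
Proof.
  intros H. induction N as [|N IH]; [reflexivity|].
  rewrite !psum_S, IH, (H (S N)); [reflexivity | lia | intros; apply H; lia].
Qed.

Lemma psum_scal c f N : psum (fun k => c * f k) N = c * psum f N.
Proof.
  induction N as [|N IH]; [rewrite !psum_0; ring|]. rewrite !psum_S, IH. ring.
Qed.

Lemma psum_minus f g N : psum (fun k => f k - g k) N = psum f N - psum g N.
Proof.
  induction N as [|N IH]; [rewrite !psum_0; ring|]. rewrite !psum_S, IH. ring.
Qed.

Lemma psum_plus f g N : psum (fun k => f k + g k) N = psum f N + psum g N.
Proof.
  induction N as [|N IH]; [rewrite !psum_0; ring|]. rewrite !psum_S, IH. ring.
Qed.

Lemma Rabs_psum_le f N B :
  (forall k, (1 <= k <= N)%nat -> Rabs (f k) <= B) ->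
  Rabs (psum f N) <= INR N * B.
Proof.
  intros H. induction N as [|N IH]; [rewrite psum_0, Rabs_R0; simpl; lra|].
  rewrite psum_S, S_INR.
  assert (H1 := Rabs_triang (psum f N) (f (S N))).
  assert (H2 := H (S N) ltac:(lia)).
  assert (H3 := IH ltac:(intros; apply H; lia)). lra.
Qed.

(** * The kernel *)

Definition od (k : nat) : R := 2 * INR k - 1.

Lemma od_S k : od (S k) = 2 * INR k + 1.
Proof. unfold od. rewrite S_INR. ring. Qed.

Lemma od_ge k : (1 <= k)%nat -> INR k <= od k.
Proof. intros H. apply le_INR in H. simpl in H. unfold od. lra. Qed.

Lemma od_ge1 k : (1 <= k)%nat -> 1 <= od k.
Proof. intros H. apply le_INR in H. simpl in H. unfold od. lra. Qed.

(** Partial Wallis product of [(2 i + 1) ^ 2 / (4 i (i + 1))] over [1 <= i < n], equal to [ker n 1].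
    The value 0 at [n = 0] keeps the cleared recurrence below valid there. *)
Fixpoint wallis (n : nat) : R :=
  match n with
  | O => 0
  | S m =>
      match m with
      | O => 1
      | S _ => wallis m * (2 * INR m + 1) ^ 2 / (4 * INR m * (INR m + 1))
      end
  end.

Lemma wallis_S n :
  4 * INR n * (INR n + 1) * wallis (S n) = (2 * INR n + 1) ^ 2 * wallis n.
Proof.
  destruct n as [|n]; [simpl; ring|].
  change (wallis (S (S n))) with
    (wallis (S n) * (2 * INR (S n) + 1) ^ 2 / (4 * INR (S n) * (INR (S n) + 1))).
  assert (H := lt_0_INR (S n) ltac:(lia)). field. split; lra.
Qed.

(* [qratio n k] is the product of [(n - i) / (n + i)] over [1 <= i < k]; the
   subtraction is real, so the product vanishes for [k > n >= 1]. *)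
Fixpoint qratio (n k : nat) : R :=
  match k with
  | O => 1
  | S k' =>
      match k' with
      | O => 1
      | S _ => qratio n k' * (INR n - INR k') / (INR n + INR k')
      end
  end.

Lemma qratio_S n k : (1 <= k)%nat ->
  qratio n (S k) * (INR n + INR k) = qratio n k * (INR n - INR k).
Proof.
  intros Hk. destruct k as [|k]; [lia|].
  change (qratio n (S (S k))) with
    (qratio n (S k) * (INR n - INR (S k)) / (INR n + INR (S k))).
  assert (H := pos_INR n). assert (H' := lt_0_INR (S k) ltac:(lia)).
  field. lra.
Qed.

(** The quotient of the products for [n + 1] and [n] telescopes to
    [n (n + 1) / ((n + 1 - k) (n + k))]. Clearing denominators also covers [k = n + 1]. *)
Lemma qratio_Sl n k : (1 <= k)%nat ->
  qratio (S n) k * (INR n + 1 - INR k) * (INR n + INR k) =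
  qratio n k * INR n * (INR n + 1).
Proof.
  intros Hk. induction k as [|k IH]; [lia|].
  destruct (Nat.eq_dec k 0) as [->|Hk0]; [simpl; ring|].
  assert (H1 := qratio_S n k ltac:(lia)).
  assert (H2 := qratio_S (S n) k ltac:(lia)).
  specialize (IH ltac:(lia)). rewrite S_INR in *.
  assert (Hn := pos_INR n). assert (Hk' := lt_0_INR k ltac:(lia)).
  apply Rmult_eq_reg_r with (INR n + INR k); [|lra].
  transitivity (qratio (S n) (S k) * (INR n + 1 + INR k) *
                (INR n - INR k) * (INR n + INR k)); [ring|].
  rewrite H2.
  transitivity (qratio (S n) k * (INR n + 1 - INR k) * (INR n + INR k) *
                (INR n - INR k)); [ring|].
  rewrite IH.
  transitivity (qratio n k * (INR n - INR k) * INR n * (INR n + 1)); [ring|].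
  rewrite <- H1. ring.
Qed.

(* [(-1) ^ (k - 1) * ker n k] is the residue product
   [prod_{j <> k, j <= n} od j ^ 2 / (od j ^ 2 - od k ^ 2)]. *)
Definition ker (n k : nat) : R := wallis n / od k * qratio n k.

(** The factor [i = n] of [qratio] vanishes, or [wallis 0] does. Kernel sums over [[1..n]] can
    therefore be extended to [n + 1]. *)
Lemma ker_out n : ker n (S n) = 0.
Proof.
  unfold ker. destruct n as [|n]; [simpl; unfold Rdiv; ring|].
  assert (H := qratio_S (S n) (S n) ltac:(lia)).
  assert (Hn := lt_0_INR (S n) ltac:(lia)).
  assert (qratio (S n) (S (S n)) = 0) as ->; [|ring].
  apply Rmult_eq_reg_r with (INR (S n) + INR (S n)); [|lra]. rewrite H. ring.
Qed.

(** For [k <= n], the residue product gains the factor [od (S n) ^ 2 / (od (S n) ^ 2 - od k ^ 2)],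
    whose denominator is [4 (n + 1 - k) (n + k)]. *)
Lemma ker_Sl n k : (1 <= k)%nat ->
  ker (S n) k - ker n k = ker (S n) k * od k ^ 2 / od (S n) ^ 2.
Proof.
  intros Hk. unfold ker.
  assert (Hb := od_ge1 k Hk). assert (HB := od_ge1 (S n) ltac:(lia)).
  assert (Hq := qratio_Sl n k Hk). assert (Hw := wallis_S n).
  apply Rmult_eq_reg_r with (od k * od (S n) ^ 2);
    [|apply Rmult_integral_contrapositive; split; [lra|apply pow_nonzero; lra]].
  transitivity (wallis (S n) * qratio (S n) k * od (S n) ^ 2
                - wallis n * qratio n k * od (S n) ^ 2); [field; lra|].
  transitivity (wallis (S n) * qratio (S n) k * od k ^ 2); [|field; lra].
  rewrite od_S. unfold od.
  assert (Hd : 4 * wallis (S n) *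
     (qratio (S n) k * (INR n + 1 - INR k) * (INR n + INR k)) =
     qratio n k * ((2 * INR n + 1) ^ 2 * wallis n)).
  { rewrite Hq, <- Hw. ring. }
  ring_simplify in Hd. ring_simplify. lra.
Qed.

(** Differencing the kernel transform in [n] multiplies the transformed sequence by [od ^ 2]. This
    drives the inductions that evaluate kernel sums. *)
Lemma ker_transform_S f n :
  psum (fun k => ker (S n) k * f k) (S n) - psum (fun k => ker n k * f k) n =
  psum (fun k => ker (S n) k * (od k ^ 2 * f k)) (S n) / od (S n) ^ 2.
Proof.
  replace (psum (fun k => ker n k * f k) n)
    with (psum (fun k => ker n k * f k) (S n))
    by (rewrite psum_S, ker_out; ring).
  transitivity (psum (fun k => (ker (S n) k - ker n k) * f k) (S n)).
  { rewrite <- psum_minus. apply psum_ext. intros; ring. }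
  unfold Rdiv. rewrite Rmult_comm, <- psum_scal.
  apply psum_ext. intros k Hk. rewrite ker_Sl by lia. unfold Rdiv. ring.
Qed.

Lemma psum_ker_transform f N :
  psum (fun n => / od n ^ 2 * psum (fun k => ker n k * f k) n) N =
  psum (fun k => ker N k * (f k / od k ^ 2)) N.
Proof.
  induction N as [|N IH]; [reflexivity|].
  rewrite psum_S, IH.
  assert (H := ker_transform_S (fun k => f k / od k ^ 2) N). cbv beta in H.
  rewrite (psum_ext (fun k => ker (S N) k * (od k ^ 2 * (f k / od k ^ 2)))
                    (fun k => ker (S N) k * f k)) in H.
  - unfold Rdiv in *. lra.
  - intros k Hk. assert (Hb := od_ge1 k ltac:(lia)). field. lra.
Qed.

(** The right-hand side is an explicit antidifference, verified with [qratio_S]. It vanishes at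
    [m = n], so the full sum is 0 for [n >= 2]. *)
Lemma psum_alt_ker_od2 n m :
  (INR n - 1) * psum (fun k => (-1) ^ k * (ker n k * od k ^ 2)) m =
  (-1) ^ m * wallis n * qratio n m * INR m * (INR n - INR m).
Proof.
  induction m as [|m IH]; [rewrite psum_0; simpl; ring|].
  rewrite psum_S, Rmult_plus_distr_l, IH. unfold ker.
  assert (Hb := od_ge1 (S m) ltac:(lia)).
  replace (wallis n / od (S m) * qratio n (S m) * od (S m) ^ 2)
    with (wallis n * qratio n (S m) * od (S m)) by (field; lra).
  rewrite od_S, S_INR. simpl pow.
  destruct m as [|m]; [simpl; ring|].
  assert (H := qratio_S n (S m) ltac:(lia)).
  transitivity ((-1) ^ S m * wallis n * INR (S m) *
                (qratio n (S m) * (INR n - INR (S m)))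
    + (INR n - 1) * (-1 * (-1) ^ S m *
        (wallis n * qratio n (S (S m)) * (2 * INR (S m) + 1)))); [ring|].
  rewrite <- H. ring.
Qed.

(** The numbers [(-1) ^ (k - 1) * ker n k] are the Lagrange interpolation weights at 0 for the nodes
    [od k ^ 2], hence sum to 1. The proof shows that the sum is constant in [n], its increment being
    the sum that vanishes by [psum_alt_ker_od2]. *)
Lemma psum_alt_ker n : (1 <= n)%nat ->
  psum (fun k => (-1) ^ k * ker n k) n = -1.
Proof.
  intros Hn. induction n as [|n IH]; [lia|].
  destruct (Nat.eq_dec n 0) as [->|Hn0].
  { unfold psum, ker, od. simpl. field. }
  assert (H := ker_transform_S (fun k => (-1) ^ k) n). cbv beta in H.
  assert (H2 := psum_alt_ker_od2 (S n) (S n)).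
  assert (Hp := lt_0_INR n ltac:(lia)).
  replace (psum (fun k => ker (S n) k * (od k ^ 2 * (-1) ^ k)) (S n))
    with 0 in H.
  - rewrite (psum_ext (fun k => ker (S n) k * (-1) ^ k)
               (fun k => (-1) ^ k * ker (S n) k)) in H by (intros; ring).
    rewrite (psum_ext (fun k => ker n k * (-1) ^ k)
               (fun k => (-1) ^ k * ker n k)) in H by (intros; ring).
    rewrite IH in H by lia. unfold Rdiv in H. lra.
  - rewrite (psum_ext (fun k => ker (S n) k * (od k ^ 2 * (-1) ^ k))
       (fun k => (-1) ^ k * (ker (S n) k * od k ^ 2))) by (intros; ring).
    (* The factor to cancel is [INR n], nonzero because the case [n = 0] was treated apart. *)
    symmetry. apply Rmult_eq_reg_l with (INR (S n) - 1).
    + rewrite H2. ring.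
    + rewrite S_INR. lra.
Qed.

(** * The dual sequences *)

Fixpoint dual (d k : nat) : R :=
  match d with
  | O => 2 * (-1) ^ k / od k ^ 2
  | S d' => psum (fun j => dual d' j / od j) k
            + psum (fun j => dual d' j / od j) (k - 1)
  end.

(** Telescoping form of prepending a 1. The boundary term carries [od m - od n], so at [m = n] the
    transform of [od ^ 2 * dual (S d)] is exactly [od n] times that of [dual d]. *)
Lemma psum_ker_dual_S d n m : (1 <= n)%nat ->
  psum (fun k => ker n k * (od k ^ 2 * dual (S d) k)) m -
    od n * psum (fun k => ker n k * dual d k) m =
  wallis n * qratio n m * psum (fun j => dual d j / od j) m * (od m - od n).
Proof.
  intros Hn. induction m as [|m IH]; [rewrite !psum_0; ring|].
  rewrite !psum_S.
  set (X := psum (fun k => ker n k * (od k ^ 2 * dual (S d) k)) m) in *.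
  set (Y := psum (fun k => ker n k * dual d k) m) in *.
  change (dual (S d) (S m)) with (psum (fun j => dual d j / od j) (S m)
     + psum (fun j => dual d j / od j) (S m - 1)).
  replace (S m - 1)%nat with m by lia. rewrite psum_S.
  set (P := psum (fun j => dual d j / od j) m) in *.
  assert (Hb := od_ge1 (S m) ltac:(lia)).
  assert (HX : X = od n * Y + wallis n * qratio n m * P * (od m - od n)) by lra.
  rewrite HX. unfold ker.
  set (u := dual d (S m)).
  assert (Hq : P * (qratio n m * (od m - od n))
               = - (P * (qratio n (S m) * (od n + od (S m))))).
  { destruct m as [|m]; [unfold P; rewrite psum_0; ring|].
    assert (H := qratio_S n (S m) ltac:(lia)).
    apply (f_equal (fun z => -2 * P * z)) in H.
    rewrite (od_S (S m)). unfold od. lra. }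
  apply Rminus_diag_uniq.
  transitivity (wallis n * (P * (qratio n m * (od m - od n))
     + (P * (qratio n (S m) * (od n + od (S m)))))); [field; lra|].
  rewrite Hq. ring.
Qed.

(** Both sides have the same increment in [n]: by [psum_alt_ker] for [d = 0], and by
    [psum_ker_dual_S] at [m = n] in the step on [d]. The minus sign appears because [ker] leaves out
    the sign [(-1) ^ (k - 1)]. *)
Lemma tstar_trunc_ones_2 d n :
  tstar_trunc (repeat 1%nat d ++ [2%nat]) n =
  - / 2 * psum (fun k => ker n k * dual d k) n.
Proof.
  revert n. induction d as [|d IHd]; intros n.
  - induction n as [|n IH]; [rewrite psum_0; simpl; ring|].
    assert (E : forall N, tstar_trunc (repeat 1%nat 0 ++ [2%nat]) N
                = psum (fun k => / od k ^ 2 * 1) N) by reflexivity.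
    rewrite E in *. rewrite psum_S, IH.
    assert (H := ker_transform_S (dual 0) n).
    rewrite (psum_ext (fun k => ker (S n) k * (od k ^ 2 * dual 0 k))
       (fun k => 2 * ((-1) ^ k * ker (S n) k))) in H.
    + rewrite psum_scal, psum_alt_ker in H by lia. unfold Rdiv in H. lra.
    + intros k Hk. assert (Hb := od_ge1 k ltac:(lia)). simpl. field. lra.
  - assert (E : forall N, tstar_trunc (repeat 1%nat (S d) ++ [2%nat]) N
      = psum (fun k => / od k ^ 1 * tstar_trunc (repeat 1%nat d ++ [2%nat]) k) N)
      by reflexivity.
    induction n as [|n IH]; [rewrite psum_0; simpl; ring|].
    rewrite E in *. rewrite psum_S, IH, IHd.
    assert (H := ker_transform_S (dual (S d)) n).
    assert (H2 := psum_ker_dual_S d (S n) (S n) ltac:(lia)).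
    rewrite Rminus_diag, Rmult_0_r in H2.
    assert (Hb := od_ge1 (S n) ltac:(lia)).
    replace (psum (fun k => ker (S n) k * (od k ^ 2 * dual (S d) k)) (S n))
      with (od (S n) * psum (fun k => ker (S n) k * dual d k) (S n)) in H by lra.
    replace (psum (fun k => ker (S n) k * dual (S d) k) (S n)) with
      (psum (fun k => ker n k * dual (S d) k) n +
       od (S n) * psum (fun k => ker (S n) k * dual d k) (S n) / od (S n) ^ 2)
      by lra.
    field. lra.
Qed.

Lemma tstar_trunc_2_ones_2 d N :
  tstar_trunc ([2%nat] ++ repeat 1%nat d ++ [2%nat]) N =
  - / 2 * psum (fun k => ker N k * (dual d k / od k ^ 2)) N.
Proof.
  rewrite <- psum_ker_transform, <- psum_scal.
  change (tstar_trunc ([2%nat] ++ repeat 1%nat d ++ [2%nat]) N) with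
    (psum (fun k => / od k ^ 2 * tstar_trunc (repeat 1%nat d ++ [2%nat]) k) N).
  apply psum_ext. intros k _. rewrite tstar_trunc_ones_2. ring.
Qed.

(** * Compositions *)

Definition lsum {A} (g : A -> R) (l : list A) : R := fold_right Rplus 0 (map g l).

Lemma lsum_app {A} (g : A -> R) l l' : lsum g (l ++ l') = lsum g l + lsum g l'.
Proof. unfold lsum. rewrite map_app. apply fold_right_Rplus_app. Qed.

Lemma lsum_map {A B} (g : B -> R) (h : A -> B) l :
  lsum g (map h l) = lsum (fun x => g (h x)) l.
Proof. unfold lsum. rewrite map_map. reflexivity. Qed.

Definition incr_first (c : list nat) : list nat :=
  match c with [] => [] | a :: c' => S a :: c' end.

(** Splits on whether the first part is 1. Unlike the defining recursion, this lowers the total by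
    exactly one. *)
Lemma compositions_SS n r :
  compositions (S n) (S r) =
  map (cons 1%nat) (compositions n r) ++ map incr_first (compositions n (S r)).
Proof.
  change (compositions (S n) (S r)) with
    (map (cons 1%nat) (compositions (n - 0) r) ++
     flat_map (fun a => map (cons a) (compositions (S n - a) r)) (seq 2 n)).
  rewrite Nat.sub_0_r. f_equal.
  change (compositions n (S r)) with
    (flat_map (fun a => map (cons a) (compositions (n - a) r)) (seq 1 n)).
  rewrite <- seq_shift. generalize (seq 1 n) as l.
  induction l as [|a l IH]; [reflexivity|].
  cbn [map flat_map]. rewrite map_app, map_map, IH. reflexivity.
Qed.

Lemma compositions_gt n r : (n < r)%nat -> compositions n r = [].
Proof.
  revert r. induction n as [|n IH]; intros [|r] Hr; try lia; [reflexivity|].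
  rewrite compositions_SS, !IH by lia. reflexivity.
Qed.

Lemma compositions_spec n r c :
  In c (compositions n r) -> length c = r /\ List.Forall (fun a => (1 <= a)%nat) c.
Proof.
  revert n c. induction r as [|r IH]; intros n c Hc.
  - destruct n; simpl in Hc; [|tauto]. destruct Hc as [<-|[]]. auto.
  - simpl in Hc. apply in_flat_map in Hc as [a [Ha Hc]].
    apply in_map_iff in Hc as [c' [<- Hc']].
    apply IH in Hc' as [Hl Hf]. apply in_seq in Ha.
    split; [simpl; lia | constructor; [lia | exact Hf]].
Qed.

(** The weight [2 ^ r] is built in so that removing one part costs a factor 2. *)
Definition csum (n : nat) (g : list nat -> R) : R :=
  psum (fun r => 2 ^ r * lsum g (compositions n r)) n.

Lemma csum_ext n g h :
  (forall c, c <> [] -> List.Forall (fun a => (1 <= a)%nat) c -> g c = h c) ->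
  csum n g = csum n h.
Proof.
  intros H. apply psum_ext. intros r Hr. f_equal. unfold lsum. f_equal.
  apply map_ext_in. intros c Hc. apply compositions_spec in Hc as [Hl Hf].
  apply H; [|exact Hf]. intros ->. simpl in Hl. lia.
Qed.

Lemma lsum_scal {A} x (g : A -> R) l : lsum (fun c => x * g c) l = x * lsum g l.
Proof.
  induction l as [|a l IH]; unfold lsum in *; simpl; [ring | rewrite IH; ring].
Qed.

Lemma lsum_plus {A} (g h : A -> R) l :
  lsum (fun c => g c + h c) l = lsum g l + lsum h l.
Proof.
  induction l as [|a l IH]; unfold lsum in *; simpl; [ring | rewrite IH; ring].
Qed.

Lemma csum_scal n x g : csum n (fun c => x * g c) = x * csum n g.
Proof.
  unfold csum. rewrite <- psum_scal. apply psum_ext. intros r _.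
  rewrite lsum_scal. ring.
Qed.

Lemma csum_plus n g h : csum n (fun c => g c + h c) = csum n g + csum n h.
Proof.
  unfold csum. rewrite <- psum_plus. apply psum_ext. intros r _.
  rewrite lsum_plus. ring.
Qed.

Lemma csum_psum n (f : nat -> list nat -> R) N :
  csum n (fun c => psum (fun k => f k c) N) = psum (fun k => csum n (f k)) N.
Proof.
  induction N as [|N IH].
  - transitivity (csum n (fun c => 0 * 0)).
    + apply csum_ext. intros. rewrite psum_0. ring.
    + rewrite csum_scal, psum_0. ring.
  - rewrite psum_S, <- IH, <- csum_plus. apply csum_ext. intros.
    apply psum_S.
Qed.

Lemma csum_S n g : (1 <= n)%nat ->
  csum (S n) g =
  2 * csum n (fun c => g (1%nat :: c)) + csum n (fun c => g (incr_first c)).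
Proof.
  intros Hn. unfold csum.
  set (h := fun r => 2 ^ r * lsum (fun c => g (1%nat :: c)) (compositions n r)).
  set (i := fun r => 2 ^ r * lsum (fun c => g (incr_first c)) (compositions n r)).
  (* The bound [M] is freed for induction. The sum of [h] stops one earlier since removing a part
     lowers [r]. *)
  assert (H : forall M, psum (fun r => 2 ^ r * lsum g (compositions (S n) r)) (S M)
              = 2 * psum h M + psum i (S M)).
  { assert (T : forall r, 2 ^ S r * lsum g (compositions (S n) (S r))
                = 2 * h r + i (S r)).
    { intros r. unfold h, i.
      rewrite compositions_SS, lsum_app, !lsum_map. simpl pow. ring. }
    assert (h 0%nat = 0) as Hh.
    { unfold h. destruct n; [lia|]. unfold lsum. simpl. ring. }
    intros M. induction M as [|M IH].
    - rewrite !psum_S, !psum_0, T, Hh. ring.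
    - rewrite psum_S, IH, T, (psum_S h M), (psum_S i (S M)). ring. }
  (* The surplus term [r = n + 1] is zero: [n] has no composition into more than [n] parts. *)
  rewrite H, (psum_S i). unfold i at 2. rewrite compositions_gt by lia.
  unfold lsum at 1. simpl. ring.
Qed.

(** * Outermost terms of the truncated alternating sums *)

Fixpoint bar_args (c : list nat) : list (nat * R) :=
  match c with
  | [] => []
  | s :: c' =>
      match c' with
      | [] => [((s + 2)%nat, -1)]
      | _ :: _ => (s, 1) :: bar_args c'
      end
  end.

Lemma bump_last_cons a b c : bump_last (a :: b :: c) = a :: bump_last (b :: c).
Proof.
  unfold bump_last. change (rev (a :: b :: c)) with (rev (b :: c) ++ [a]).
  destruct (rev (b :: c)) as [|x l] eqn:E.
  - apply (f_equal (@length nat)) in E. rewrite length_rev in E. discriminate.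
  - simpl. rewrite rev_app_distr. reflexivity.
Qed.

(** [bump_last] works through [rev], whereas [bar_args] recurses from the front and so is compatible
    with peeling off first parts. *)
Lemma bar_args_bump_last c : c <> [] ->
  combine (bump_last c) (repeat 1 (length (bump_last c) - 1) ++ [-1]) =
  bar_args c.
Proof.
  induction c as [|a [|b c] IH]; intros Hc; [tauto | reflexivity |].
  rewrite bump_last_cons. specialize (IH ltac:(discriminate)).
  change (bar_args (a :: b :: c)) with ((a, 1) :: bar_args (b :: c)).
  rewrite <- IH.
  assert (length (bump_last (b :: c)) <> 0%nat) as Hl.
  { unfold bump_last. rewrite length_rev.
    destruct (rev (b :: c)) eqn:E; [|simpl; lia].
    apply (f_equal (@length nat)) in E. rewrite length_rev in E. discriminate. }
  destruct (bump_last (b :: c)) as [|x l]; [simpl in Hl; lia|].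
  simpl. rewrite Nat.sub_0_r. reflexivity.
Qed.

Lemma t_args_bar_args c : c <> [] -> t_args c = bar_args (bump_first c).
Proof.
  intros Hc. unfold t_args. apply bar_args_bump_last.
  destruct c; [tauto | discriminate].
Qed.

(** Fixing the outermost index [k] isolates the first part, whose exponent enters only through
    [od k]. The default 0 is not reached from a nonempty [c]. *)
Definition head_term (c : list nat) (k : nat) : R :=
  match bar_args c with
  | [] => 0
  | (a, sg) :: l => sg ^ k / od k ^ a * talt_trunc l (k - 1)
  end.

Lemma talt_trunc_head_term c N : c <> [] ->
  talt_trunc (bar_args c) N = psum (head_term c) N.
Proof.
  intros Hc. unfold head_term.
  destruct (bar_args c) as [|[a sg] l] eqn:E; [|reflexivity].
  destruct c as [|s [|s' c]]; [tauto | discriminate E | discriminate E].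
Qed.

Lemma head_term_shift s m c k : (1 <= k)%nat ->
  head_term ((s + m)%nat :: c) k = head_term (s :: c) k / od k ^ m.
Proof.
  intros Hk. assert (Hb := od_ge1 k Hk).
  assert (Hp : forall j, od k ^ j <> 0) by (intros; apply pow_nonzero; lra).
  unfold head_term. destruct c as [|s' c]; simpl bar_args; cbv beta iota zeta.
  - rewrite !pow_add. field. repeat split; try apply Hp; lra.
  - rewrite !pow_add. field. repeat split; apply Hp.
Qed.

Lemma head_term_one c k : c <> [] ->
  head_term (1%nat :: c) k = / od k * talt_trunc (bar_args c) (k - 1).
Proof.
  intros Hc. destruct c as [|s c]; [tauto|].
  change (head_term (1%nat :: s :: c) k) with
    (1 ^ k / od k ^ 1 * talt_trunc (bar_args (s :: c)) (k - 1)).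
  rewrite pow1, pow_1. unfold Rdiv. ring.
Qed.

(** Let [P] be the partial sums of [dual n j / od j]. In [csum_S] a first part 1 contributes
    [2 P (k - 1) / od k] and a raised first part [dual n k / od k ^ 2]. Since
    [P k - P (k - 1) = dual n k / od k], they add up to [(P k + P (k - 1)) / od k], which is the
    recursion of [dual]. *)
Lemma csum_head_term n k : (1 <= k)%nat ->
  csum (S n) (fun c => head_term c k) = dual n k / od k.
Proof.
  revert k. induction n as [|n IH]; intros k Hk; assert (Hb := od_ge1 k Hk).
  - unfold csum, psum, lsum, head_term. simpl. field. lra.
  - rewrite csum_S by lia.
    rewrite (csum_ext (S n) (fun c => head_term (1%nat :: c) k)
       (fun c => / od k * psum (fun j => head_term c j) (k - 1))).
    2:{ intros c Hc _. rewrite head_term_one, talt_trunc_head_term by exact Hc.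
        reflexivity. }
    rewrite (csum_ext (S n) (fun c => head_term (incr_first c) k)
       (fun c => / od k * head_term c k)).
    2:{ intros [|s c] Hc _; [tauto|]. simpl incr_first.
        rewrite <- Nat.add_1_r, head_term_shift by exact Hk.
        rewrite pow_1. unfold Rdiv. ring. }
    rewrite !csum_scal, IH by exact Hk.
    rewrite (csum_psum (S n) (fun j c => head_term c j)).
    rewrite (psum_ext (fun j => csum (S n) (fun c => head_term c j))
               (fun j => dual n j / od j)) by (intros; apply IH; lia).
    change (dual (S n) k) with (psum (fun j => dual n j / od j) k
            + psum (fun j => dual n j / od j) (k - 1)).
    destruct k as [|k]; [lia|]. rewrite psum_S.
    replace (S k - 1)%nat with k by lia. field. lra.
Qed.

(** The 2 that [t_args] adds to the first part turns into a factor [/ od k ^ 2] on each head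
    term. *)
Lemma csum_talt_trunc d N :
  csum (S d) (fun c => talt_trunc (t_args c) N) =
  psum (fun k => dual d k / od k ^ 3) N.
Proof.
  rewrite (csum_ext (S d) _ (fun c => psum (fun k => / od k ^ 2 * head_term c k) N)).
  - rewrite (csum_psum (S d) (fun k c => / od k ^ 2 * head_term c k)).
    apply psum_ext. intros k Hk. rewrite csum_scal, csum_head_term by lia.
    assert (Hb := od_ge1 k ltac:(lia)). field. lra.
  - intros [|s c] Hc _; [tauto|].
    rewrite t_args_bar_args by exact Hc. simpl bump_first.
    rewrite talt_trunc_head_term by discriminate.
    apply psum_ext. intros k Hk. rewrite head_term_shift by lia.
    unfold Rdiv. ring.
Qed.

(** * Sums dominated by [sum 1 / (2 k - 1) ^ 2] *)

(** Comparison with a telescoping series: [1 / (2 N + 1) ^ 2 <= 1 / (N (N + 1)) = 1 / N - 1 / (N +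
    1)]. *)
Lemma Rabs_psum_tail f C K N :
  (1 <= K)%nat -> (K <= N)%nat -> 0 <= C ->
  (forall k, (1 <= k <= N)%nat -> Rabs (f k) <= C / od k ^ 2) ->
  Rabs (psum f N - psum f K) <= C / INR K.
Proof.
  intros HK HKN HC Hf.
  apply Rle_trans with (C * (/ INR K - / INR N)).
  - induction HKN as [|N HKN IH].
    + rewrite !Rminus_diag, Rabs_R0. lra.
    + rewrite psum_S.
      specialize (IH ltac:(intros; apply Hf; lia)).
      specialize (Hf (S N) ltac:(lia)).
      assert (HN := lt_0_INR N ltac:(lia)).
      assert (/ od (S N) ^ 2 <= / INR N - / INR (S N)).
      { rewrite od_S, S_INR.
        replace (/ INR N - / (INR N + 1)) with (/ (INR N * (INR N + 1)))
          by (field; lra).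
        apply Rinv_le_contravar; nra. }
      apply Rmult_le_compat_l with (r := C) in H; [|exact HC].
      replace (psum f N + f (S N) - psum f K)
        with ((psum f N - psum f K) + f (S N)) by ring.
      assert (HT := Rabs_triang (psum f N - psum f K) (f (S N))).
      unfold Rdiv in *. lra.
  - assert (0 < INR N) by (apply lt_0_INR; lia).
    assert (0 < / INR N) by (apply Rinv_0_lt_compat; lra).
    unfold Rdiv. nra.
Qed.

Lemma small_quotient C (eps : posreal) :
  0 <= C -> exists K, (1 <= K)%nat /\ C / INR K < eps.
Proof.
  intros HC. destruct eps as [e He]; simpl.
  destruct (INR_unbounded (C / e)) as [K HK].
  exists (S K). split; [lia|].
  assert (H := lt_0_INR (S K) ltac:(lia)).
  apply Rmult_lt_reg_r with (INR (S K)); [exact H|].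
  replace (C / INR (S K) * INR (S K)) with (C / e * e) by (field; lra).
  rewrite (Rmult_comm e). apply Rmult_lt_compat_r; [exact He|].
  rewrite S_INR. lra.
Qed.

Lemma ex_lim_psum f C : 0 <= C ->
  (forall k, (1 <= k)%nat -> Rabs (f k) <= C / od k ^ 2) ->
  ex_finite_lim_seq (psum f).
Proof.
  intros HC Hf. apply ex_lim_seq_cauchy_corr. intros eps.
  destruct (small_quotient (2 * C) eps ltac:(lra)) as [K [HK HKe]].
  exists K. intros n m Hn Hm.
  assert (H1 := Rabs_psum_tail f C K n HK Hn HC ltac:(intros; apply Hf; lia)).
  assert (H2 := Rabs_psum_tail f C K m HK Hm HC ltac:(intros; apply Hf; lia)).
  replace (psum f n - psum f m)
    with ((psum f n - psum f K) - (psum f m - psum f K)) by ring.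
  assert (HT := Rabs_triang (psum f n - psum f K) (- (psum f m - psum f K))).
  rewrite Rabs_Ropp in HT. unfold Rminus, Rdiv in *. lra.
Qed.

Lemma is_lim_seq_psum (f : nat -> nat -> R) (g : nat -> R) K :
  (forall k, (1 <= k <= K)%nat -> is_lim_seq (fun n => f n k) (g k)) ->
  is_lim_seq (fun n => psum (f n) K) (psum g K).
Proof.
  intros H. induction K as [|K IH].
  - rewrite psum_0. apply is_lim_seq_const.
  - rewrite psum_S.
    apply is_lim_seq_ext with (fun n => psum (f n) K + f n (S K));
      [intros; rewrite psum_S; reflexivity|].
    apply is_lim_seq_plus'; [apply IH; intros; apply H; lia | apply H; lia].
Qed.

Lemma is_lim_seq_Rabs_le u (l c B : R) :
  is_lim_seq u l -> eventually (fun n => Rabs (u n - c) <= B) -> Rabs (l - c) <= B.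
Proof.
  intros Hu HB.
  assert (H : is_lim_seq (fun n => Rabs (u n - c)) (Rabs (l - c))).
  { apply (is_lim_seq_abs _ (l - c)).
    apply is_lim_seq_minus'; [exact Hu | apply is_lim_seq_const]. }
  exact (is_lim_seq_le_loc _ _ _ _ HB H (is_lim_seq_const B)).
Qed.

(** Tannery's theorem: cut both sums at a fixed [K], where the limit is termwise, and bound the two
    tails uniformly in [n]. *)
Lemma tannery (f : nat -> nat -> R) (g : nat -> R) C (l : R) : 0 <= C ->
  (forall n k, (1 <= k <= n)%nat -> Rabs (f n k) <= C / od k ^ 2) ->
  (forall k, (1 <= k)%nat -> is_lim_seq (fun n => f n k) (g k)) ->
  is_lim_seq (psum g) l ->
  is_lim_seq (fun n => psum (f n) n) l.
Proof.
  intros HC Hf Hfg Hl.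
  assert (Hg : forall k, (1 <= k)%nat -> Rabs (g k) <= C / od k ^ 2).
  { intros k Hk. rewrite <- (Rminus_0_r (g k)).
    apply (is_lim_seq_Rabs_le _ _ 0 _ (Hfg k Hk)).
    exists k. intros n Hn. rewrite Rminus_0_r. apply Hf. lia. }
  apply is_lim_seq_spec. intros eps. simpl.
  (* Each of the two tails gets [eps / 4], the finite part [eps / 2]. *)
  destruct (small_quotient (4 * C) eps ltac:(lra)) as [K [HK HKe]].
  assert (H := is_lim_seq_psum f g K ltac:(intros; apply Hfg; lia)).
  apply is_lim_seq_spec in H.
  destruct (H (pos_div_2 eps)) as [M HM]. simpl in HM.
  exists (max K M). intros n Hn.
  assert (H1 := HM n ltac:(lia)).
  assert (H2 := Rabs_psum_tail (f n) C K n HK ltac:(lia) HC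
                 ltac:(intros; apply Hf; lia)).
  assert (H3 : Rabs (l - psum g K) <= C / INR K).
  { apply (is_lim_seq_Rabs_le _ _ _ _ Hl). exists K. intros m Hm.
    apply Rabs_psum_tail; try assumption. intros; apply Hg; lia. }
  replace (psum (f n) n - l) with ((psum (f n) n - psum (f n) K)
    + (psum (f n) K - psum g K) + - (l - psum g K)) by ring.
  eapply Rle_lt_trans; [apply Rabs_triang|].
  rewrite Rabs_Ropp.
  assert (HT := Rabs_triang (psum (f n) n - psum (f n) K) (psum (f n) K - psum g K)).
  unfold Rdiv in *. lra.
Qed.

(** * Convergence of the kernel *)

Lemma wallis_pos n : (1 <= n)%nat -> 0 < wallis n.
Proof.
  intros Hn. induction Hn as [|n Hn IH]; [simpl; lra|].
  assert (H := wallis_S n). assert (Hp := lt_0_INR n ltac:(lia)).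
  apply Rmult_lt_reg_l with (4 * INR n * (INR n + 1)); [nra|].
  rewrite H, Rmult_0_r. apply Rmult_lt_0_compat; [|exact IH]. nra.
Qed.

Lemma wallis_incr n : wallis n <= wallis (S n).
Proof.
  destruct n as [|n]; [simpl; lra|].
  assert (H := wallis_S (S n)). assert (Hp := lt_0_INR (S n) ltac:(lia)).
  assert (Hw := wallis_pos (S n) ltac:(lia)).
  apply Rmult_le_reg_l with (4 * INR (S n) * (INR (S n) + 1)); [nra|].
  rewrite H. nra.
Qed.

Lemma qratio_S_bounds n k : (1 <= k <= n)%nat -> 0 <= qratio n k ->
  0 <= qratio n (S k) <= qratio n k.
Proof.
  intros Hk Hq. assert (H := qratio_S n k ltac:(lia)).
  assert (Hp := lt_0_INR k ltac:(lia)).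
  assert (Hkn : INR k <= INR n) by (apply le_INR; lia).
  split.
  - apply Rmult_le_reg_r with (INR n + INR k); [lra|]. rewrite H, Rmult_0_l.
    apply Rmult_le_pos; lra.
  - apply Rmult_le_reg_r with (INR n + INR k); [lra|]. rewrite H.
    apply Rmult_le_compat_l; lra.
Qed.

Lemma qratio_bounds n k : (1 <= k <= S n)%nat -> 0 <= qratio n k <= 1.
Proof.
  intros Hk. induction k as [|k IH]; [lia|].
  destruct (Nat.eq_dec k 0) as [->|Hk0]; [simpl; lra|].
  specialize (IH ltac:(lia)).
  assert (H := qratio_S_bounds n k ltac:(lia) (proj1 IH)). lra.
Qed.

Lemma ker_pos n k : (1 <= k <= n)%nat -> 0 <= ker n k.
Proof.
  intros Hk. unfold ker, Rdiv.
  assert (Hb := od_ge1 k ltac:(lia)). assert (Hw := wallis_pos n ltac:(lia)).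
  assert (Hq := qratio_bounds n k ltac:(lia)).
  assert (0 < / od k) by (apply Rinv_0_lt_compat; lra).
  apply Rmult_le_pos; [|lra]. apply Rmult_le_pos; lra.
Qed.

Lemma ker_le n k : (1 <= k <= n)%nat -> ker n k <= wallis n / od k.
Proof.
  intros Hk. unfold ker, Rdiv.
  assert (Hb := od_ge1 k ltac:(lia)). assert (Hw := wallis_pos n ltac:(lia)).
  assert (Hq := qratio_bounds n k ltac:(lia)).
  assert (0 < / od k) by (apply Rinv_0_lt_compat; lra).
  rewrite <- (Rmult_1_r (wallis n * / od k)) at 2.
  apply Rmult_le_compat_l; [|lra]. apply Rmult_le_pos; lra.
Qed.

Lemma ker_decr n k : (1 <= k)%nat -> (S k <= n)%nat -> ker n (S k) <= ker n k.
Proof.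
  intros Hk Hkn. unfold ker, Rdiv.
  assert (Hb := od_ge1 k ltac:(lia)). assert (Hw := wallis_pos n ltac:(lia)).
  assert (Hq := qratio_bounds n k ltac:(lia)).
  assert (Hq' := qratio_S_bounds n k ltac:(lia) (proj1 Hq)).
  assert (0 < / od (S k)) by (apply Rinv_0_lt_compat; rewrite od_S; unfold od in *; lra).
  assert (/ od (S k) <= / od k).
  { apply Rinv_le_contravar; [lra|]. rewrite od_S. unfold od. lra. }
  apply Rmult_le_compat; [apply Rmult_le_pos; lra | lra | | lra].
  apply Rmult_le_compat_l; lra.
Qed.

(** Leibniz' criterion in finite form. After splitting off the term at [K + 1], the rest has the
    opposite sign and is at most [f (K + 2) <= f (K + 1)] in size. *)
Lemma alternating_remainder f n K m : (K + m <= n)%nat ->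
  (forall k, (1 <= k <= n)%nat -> 0 <= f k) ->
  (forall k, (1 <= k)%nat -> (S k <= n)%nat -> f (S k) <= f k) ->
  (1 <= m)%nat ->
  0 <= (-1) ^ S K * (psum (fun k => (-1) ^ k * f k) (K + m)
                   - psum (fun k => (-1) ^ k * f k) K) <= f (S K).
Proof.
  intros HKm Hp Hd Hm. revert K HKm.
  assert (Hs : forall j, (-1) ^ j * (-1) ^ j = 1).
  { intros j. rewrite <- Rpow_mult_distr. replace (-1 * -1) with 1 by ring.
    apply pow1. }
  induction Hm as [|m Hm IH]; intros K HKm.
  - rewrite Nat.add_1_r, psum_S.
    replace (_ * _) with ((-1) ^ S K * (-1) ^ S K * f (S K)) by ring.
    rewrite Hs. assert (H := Hp (S K) ltac:(lia)). lra.
  - specialize (IH (S K) ltac:(lia)).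
    replace (K + S m)%nat with (S K + m)%nat by lia.
    set (X := psum (fun k => (-1) ^ k * f k) (S K + m)) in *.
    rewrite psum_S in IH. set (Y := psum (fun k => (-1) ^ k * f k) K) in *.
    assert (H1 := Hp (S K) ltac:(lia)).
    assert (H2 := Hd (S K) ltac:(lia) ltac:(lia)).
    replace ((-1) ^ S (S K) * (X - (Y + (-1) ^ S K * f (S K))))
      with ((-1) ^ S K * (-1) ^ S K * f (S K) - (-1) ^ S K * (X - Y)) in IH
      by (simpl; ring).
    rewrite Hs in IH. lra.
Qed.

(** The sum up to [n] is exactly -1, so the difference is an alternating tail with decreasing
    terms. *)
Lemma psum_alt_ker_remainder n K : (K < n)%nat ->
  Rabs (psum (fun k => (-1) ^ k * ker n k) K - -1) <= ker n (S K).
Proof.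
  intros HK.
  assert (H := alternating_remainder (ker n) n K (n - K) ltac:(lia)
     (ker_pos n) (ker_decr n) ltac:(lia)).
  replace (K + (n - K))%nat with n in H by lia.
  rewrite psum_alt_ker in H by lia.
  rewrite <- (Rmult_1_l (Rabs _)), <- (pow_1_abs (S K)), <- Rabs_mult.
  replace ((-1) ^ S K * (psum (fun k => (-1) ^ k * ker n k) K - -1)) with
    (- ((-1) ^ S K * (-1 - psum (fun k => (-1) ^ k * ker n k) K))) by ring.
  rewrite Rabs_Ropp, Rabs_pos_eq; lra.
Qed.

Lemma wallis_le n : wallis n <= 3 / 2.
Proof.
  destruct n as [|[|n]]; [simpl; lra | simpl; lra |].
  (* With [w] the Wallis value, the partial sum at [K = 1] is [- w] and the next kernel value is at
     most [w / 3]. Hence [w - 1 <= w / 3], that is [w <= 3 / 2]. *)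
  assert (H := psum_alt_ker_remainder (S (S n)) 1 ltac:(lia)).
  assert (H2 := ker_le (S (S n)) 2 ltac:(lia)).
  unfold psum, ker at 1 in H. cbn [List.seq map fold_right qratio] in H.
  apply Rabs_le_between in H.
  unfold od in *. simpl INR in *. simpl pow in H. lra.
Qed.

Lemma is_lim_seq_qratio k : (1 <= k)%nat -> is_lim_seq (fun n => qratio n k) 1.
Proof.
  intros Hk. induction Hk as [|k Hk IH]; [apply is_lim_seq_const|].
  assert (Hi : is_lim_seq (fun n => / INR (n + k)) 0).
  { apply (is_lim_seq_incr_n (fun n => / INR n)).
    apply (is_lim_seq_inv _ p_infty); [apply is_lim_seq_INR | discriminate]. }
  assert (Hk' := lt_0_INR k ltac:(lia)).
  apply is_lim_seq_ext with (fun n => qratio n k * (1 - 2 * INR k * / INR (n + k))).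
  { intros n. assert (H := qratio_S n k Hk). assert (Hn := pos_INR n).
    rewrite plus_INR.
    apply Rmult_eq_reg_r with (INR n + INR k); [|lra]. rewrite H. field. lra. }
  replace (Finite 1) with (Finite (1 * (1 - 2 * INR k * 0))) by (f_equal; ring).
  apply is_lim_seq_mult'; [exact IH|].
  apply is_lim_seq_minus'; [apply is_lim_seq_const|].
  apply is_lim_seq_mult'; [apply is_lim_seq_const | exact Hi].
Qed.

Lemma is_lim_seq_ker (L : R) k : is_lim_seq wallis L -> (1 <= k)%nat ->
  is_lim_seq (fun n => ker n k) (L / od k).
Proof.
  intros HL Hk. replace (L / od k) with (L * / od k * 1) by (unfold Rdiv; ring).
  apply is_lim_seq_mult'; [|apply is_lim_seq_qratio, Hk].
  apply is_lim_seq_mult'; [exact HL | apply is_lim_seq_const].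
Qed.

Lemma leibniz : is_lim_seq (psum (fun k => (-1) ^ k / od k)) (- (PI / 4)).
Proof.
  assert (H : is_lim_seq (fun N => sum_f_R0 (tg_alt PI_tg) N) (PI / 4)).
  { rewrite <- Alt_PI_eq. unfold Alt_PI. destruct exist_PI as [l Hl].
    replace (4 * l / 4) with l by field. apply is_lim_seq_Reals, Hl. }
  apply is_lim_seq_incr_1.
  apply is_lim_seq_ext with (fun N => - sum_f_R0 (tg_alt PI_tg) N).
  2:{ apply (is_lim_seq_opp _ (PI / 4)), H. }
  (* The library series starts at index 0, so [i] corresponds to [k = i + 1] and the sign flips. *)
  assert (T : forall i, - tg_alt PI_tg i = (-1) ^ S i / od (S i)).
  { intros i. unfold tg_alt, PI_tg. rewrite od_S, plus_INR, mult_INR.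
    simpl. assert (Hi := pos_INR i). field. lra. }
  intros N. induction N as [|N IH].
  - rewrite psum_S, psum_0, <- T. simpl. ring.
  - rewrite psum_S, <- IH, <- T. simpl. ring.
Qed.

(* The limit is pinned down by comparing [psum_alt_ker] with Leibniz' series:
   the tail of an alternating sum is at most its first term. *)
Lemma is_lim_seq_wallis : is_lim_seq wallis (4 / PI).
Proof.
  destruct (ex_finite_lim_seq_incr wallis (3 / 2) wallis_incr wallis_le)
    as [L HL].
  replace (4 / PI) with L; [exact HL|].
  assert (Hker := fun k => is_lim_seq_ker L k HL).
  assert (HK : forall K, Rabs (L * psum (fun k => (-1) ^ k / od k) K - -1)
                         <= L / od (S K)).
  { intros K.
    assert (H1 : is_lim_seq (fun n => psum (fun k => (-1) ^ k * ker n k) K)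
                   (L * psum (fun k => (-1) ^ k / od k) K)).
    { rewrite <- psum_scal. apply is_lim_seq_psum. intros k Hk.
      replace (L * ((-1) ^ k / od k)) with ((-1) ^ k * (L / od k))
        by (unfold Rdiv; ring).
      apply is_lim_seq_mult'; [apply is_lim_seq_const | apply Hker; lia]. }
    assert (H2 : is_lim_seq (fun n => Rabs (psum (fun k => (-1) ^ k * ker n k) K - -1))
       (Rabs (L * psum (fun k => (-1) ^ k / od k) K - -1))).
    { apply (is_lim_seq_abs _ (_ - -1)).
      apply is_lim_seq_minus'; [exact H1 | apply is_lim_seq_const]. }
    (* For fixed [K] the remainder bound passes to the limit in [n]. *)
    refine (is_lim_seq_le_loc _ _ _ _ _ H2 (Hker (S K) ltac:(lia))).
    exists (S K). intros n Hn. apply psum_alt_ker_remainder. lia. }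
  assert (Hlim : is_lim_seq (fun K => L * psum (fun k => (-1) ^ k / od k) K) (-1)).
  { apply is_lim_seq_spec. intros eps. simpl.
    assert (HL0 : 0 <= L).
    { assert (H := HK 0%nat). rewrite od_S in H. simpl INR in H.
      assert (H' := Rabs_pos (L * psum (fun k => (-1) ^ k / od k) 0 - -1)). lra. }
    destruct (small_quotient L eps HL0) as [M [HM HMe]].
    exists M. intros K HMK. eapply Rle_lt_trans; [apply HK|].
    eapply Rle_lt_trans; [|exact HMe].
    unfold Rdiv. apply Rmult_le_compat_l; [exact HL0|].
    assert (HM0 := lt_0_INR M ltac:(lia)).
    apply Rinv_le_contravar; [exact HM0|].
    apply le_INR in HMK. rewrite od_S. lra. }
  assert (Hlim' : is_lim_seq (fun K => L * psum (fun k => (-1) ^ k / od k) K)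
                    (L * - (PI / 4))).
  { apply is_lim_seq_mult'; [apply is_lim_seq_const | apply leibniz]. }
  assert (E : -1 = L * - (PI / 4)).
  { apply is_lim_seq_unique in Hlim. apply is_lim_seq_unique in Hlim'.
    rewrite Hlim in Hlim'. now injection Hlim'. }
  assert (HPI := PI_RGT_0).
  apply Rmult_eq_reg_r with (PI / 4); [|lra].
  replace (4 / PI * (PI / 4)) with 1 by (field; lra). lra.
Qed.

(** * Growth bounds and the limit of both sides *)

(** Since [od j >= j], linear growth of [dual d] bounds each [dual d j / od j] by a constant. Its
    partial sums are again linear, and adding two of them doubles the constant. *)
Lemma Rabs_dual_le d k : (1 <= k)%nat -> Rabs (dual d k) <= 2 ^ S d * INR k.
Proof.
  revert k. induction d as [|d IH]; intros k Hk.
  - assert (Hb := od_ge1 k Hk). assert (Hk1 := le_INR 1 k Hk). simpl INR in Hk1.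
    assert (1 <= od k ^ 2) by (simpl; nra).
    change (dual 0 k) with (2 * (-1) ^ k / od k ^ 2).
    unfold Rdiv. rewrite !Rabs_mult, pow_1_abs.
    rewrite (Rabs_pos_eq 2) by lra.
    assert (0 < / od k ^ 2 <= 1).
    { split; [apply Rinv_0_lt_compat; lra|].
      rewrite <- Rinv_1. apply Rinv_le_contravar; lra. }
    rewrite Rabs_pos_eq, pow_1 by lra. lra.
  - assert (H : forall N, Rabs (psum (fun j => dual d j / od j) N)
                          <= INR N * 2 ^ S d).
    { intros N. apply Rabs_psum_le. intros j Hj.
      assert (Hb := od_ge1 j ltac:(lia)). assert (Hb' := od_ge j ltac:(lia)).
      specialize (IH j ltac:(lia)).
      unfold Rdiv. rewrite Rabs_mult, Rabs_inv, (Rabs_pos_eq (od j)) by lra.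
      apply Rmult_le_reg_r with (od j); [lra|].
      rewrite Rmult_assoc, Rinv_l, Rmult_1_r by lra.
      eapply Rle_trans; [exact IH|].
      apply Rmult_le_compat_l; [apply pow_le; lra | exact Hb']. }
    change (dual (S d) k) with (psum (fun j => dual d j / od j) k
            + psum (fun j => dual d j / od j) (k - 1)).
    eapply Rle_trans; [apply Rabs_triang|].
    assert (H1 := H k). assert (H2 := H (k - 1)%nat).
    assert (Hk' : INR (k - 1) <= INR k) by (apply le_INR; lia).
    assert (0 < 2 ^ S d) by (apply pow_lt; lra).
    change (2 ^ S (S d)) with (2 * 2 ^ S d). nra.
Qed.

(** The final [/ od k] is the one supplied by [ker_le]; it absorbs the linear growth of [dual] and
    leaves a summable bound. *)
Lemma Rabs_dual_cube_le d k : (1 <= k)%nat ->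
  Rabs (dual d k / od k ^ 2) / od k <= 2 ^ S d / od k ^ 2.
Proof.
  intros Hk. assert (H := Rabs_dual_le d k Hk).
  assert (Hb := od_ge1 k Hk). assert (Hb' := od_ge k Hk).
  assert (0 < od k ^ 2) by (apply pow_lt; lra).
  assert (0 < 2 ^ S d) by (apply pow_lt; lra).
  unfold Rdiv at 2. rewrite Rabs_mult, (Rabs_pos_eq (/ _))
    by (left; apply Rinv_0_lt_compat; lra).
  apply Rmult_le_reg_r with (od k ^ 2 * od k); [nra|].
  replace (Rabs (dual d k) * / od k ^ 2 / od k * (od k ^ 2 * od k))
    with (Rabs (dual d k)) by (field; lra).
  replace (2 ^ S d / od k ^ 2 * (od k ^ 2 * od k)) with (2 ^ S d * od k)
    by (field; lra).
  nra.
Qed.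


Lemma is_lim_seq_tstar_trunc d (l : R) :
  is_lim_seq (psum (fun k => dual d k / od k ^ 3)) l ->
  is_lim_seq (tstar_trunc ([2%nat] ++ repeat 1%nat d ++ [2%nat]))
    (- (2 / PI) * l).
Proof.
  intros Hl.
  apply is_lim_seq_ext with
    (fun N => - / 2 * psum (fun k => ker N k * (dual d k / od k ^ 2)) N).
  { intros N. symmetry. apply tstar_trunc_2_ones_2. }
  assert (HPI := PI_RGT_0).
  replace (- (2 / PI) * l) with (- / 2 * (4 / PI * l)) by (field; lra).
  apply is_lim_seq_mult'; [apply is_lim_seq_const|].
  (* The constant combines [3 / 2] from [wallis_le] with [2 ^ S d] from [Rabs_dual_cube_le]. *)
  apply (tannery (fun N k => ker N k * (dual d k / od k ^ 2))
           (fun k => 4 / PI * (dual d k / od k ^ 3)) (3 / 2 * 2 ^ S d)).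
  - assert (0 <= 2 ^ S d) by (apply pow_le; lra). lra.
  - intros n k Hk. assert (H := Rabs_dual_cube_le d k ltac:(lia)).
    assert (Hb := od_ge1 k ltac:(lia)).
    assert (Hp := ker_pos n k Hk). assert (Hu := ker_le n k Hk).
    assert (Hw := wallis_le n).
    rewrite Rabs_mult, (Rabs_pos_eq (ker n k)) by exact Hp.
    assert (0 < / od k) by (apply Rinv_0_lt_compat; lra).
    assert (Hu' : ker n k <= 3 / 2 * / od k) by (unfold Rdiv in *; nra).
    assert (Hd := Rabs_pos (dual d k / od k ^ 2)).
    apply Rle_trans with (3 / 2 * (Rabs (dual d k / od k ^ 2) / od k)).
    + apply Rmult_le_compat_r with (r := Rabs (dual d k / od k ^ 2)) in Hu';
        [|exact Hd].
      replace (3 / 2 * (Rabs (dual d k / od k ^ 2) / od k))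
        with (3 / 2 * / od k * Rabs (dual d k / od k ^ 2)) by (field; lra).
      exact Hu'.
    + unfold Rdiv in *. lra.
  - intros k Hk. assert (Hb := od_ge1 k Hk).
    replace (4 / PI * (dual d k / od k ^ 3))
      with (4 / PI / od k * (dual d k / od k ^ 2)) by (field; lra).
    apply is_lim_seq_mult'; [apply is_lim_seq_ker; [apply is_lim_seq_wallis | exact Hk]
                             | apply is_lim_seq_const].
  - apply is_lim_seq_ext with
      (fun N => 4 / PI * psum (fun k => dual d k / od k ^ 3) N).
    { intros N. symmetry. apply psum_scal. }
    apply is_lim_seq_mult'; [apply is_lim_seq_const | exact Hl].
Qed.

(** * Convergence of the alternating t-values *)

Definition admissible (p : nat * R) : Prop := (1 <= fst p)%nat /\ Rabs (snd p) = 1.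

Lemma bar_args_admissible c :
  List.Forall (fun a => (1 <= a)%nat) c -> List.Forall admissible (bar_args c).
Proof.
  intros H. induction H as [|s c Hs Hc IH]; [constructor|].
  destruct c as [|s' c]; simpl bar_args.
  - constructor; [|constructor]. split; simpl; [lia|].
    rewrite Rabs_left; lra.
  - constructor; [|exact IH]. split; simpl; [lia | apply Rabs_R1].
Qed.

(** The inner sum is at most [k <= od k], which costs one power of [od k]. The case [m = 0]
    propagates linear growth, and [m = 2] gives convergence. *)
Lemma Rabs_talt_term a m sg l k : (1 <= k)%nat -> (S m <= a)%nat ->
  Rabs sg = 1 -> Rabs (talt_trunc l (k - 1)) <= INR (k - 1) + 1 ->
  Rabs (sg ^ k / od k ^ a * talt_trunc l (k - 1)) <= / od k ^ m.
Proof.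
  intros Hk Ha Hsg Hl.
  assert (Hb := od_ge1 k Hk). assert (Hb' := od_ge k Hk).
  rewrite minus_INR in Hl by lia. simpl INR in Hl.
  assert (Hm : 0 < od k ^ m) by (apply pow_lt; lra).
  assert (Hp : od k ^ S m <= od k ^ a) by (apply Rle_pow; assumption).
  simpl pow in Hp.
  assert (0 < od k ^ a) by (apply pow_lt; lra).
  unfold Rdiv. rewrite !Rabs_mult, Rabs_inv, <- RPow_abs, Hsg, pow1, Rmult_1_l.
  rewrite (Rabs_pos_eq (od k ^ a)) by lra.
  apply Rmult_le_reg_r with (od k ^ a * od k ^ m); [nra|].
  replace (/ od k ^ a * Rabs (talt_trunc l (k - 1)) * (od k ^ a * od k ^ m))
    with (Rabs (talt_trunc l (k - 1)) * od k ^ m) by (field; lra).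
  replace (/ od k ^ m * (od k ^ a * od k ^ m)) with (od k ^ a) by (field; lra).
  nra.
Qed.

Lemma Rabs_talt_trunc_le l N : List.Forall admissible l ->
  Rabs (talt_trunc l N) <= INR N + 1.
Proof.
  intros H. revert N. induction H as [|[a sg] l [Ha Hsg] Hl IH]; intros N.
  - simpl. rewrite Rabs_R1. assert (H := pos_INR N). lra.
  - change (talt_trunc ((a, sg) :: l) N) with
      (psum (fun k => sg ^ k / od k ^ a * talt_trunc l (k - 1)) N).
    apply Rle_trans with (INR N * 1); [|lra]. apply Rabs_psum_le.
    intros k Hk. apply Rle_trans with (/ od k ^ 0); [|simpl; lra].
    apply Rabs_talt_term; auto. lia.
Qed.

Lemma ex_lim_talt_trunc a sg l : (3 <= a)%nat -> Rabs sg = 1 ->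
  List.Forall admissible l -> ex_finite_lim_seq (talt_trunc ((a, sg) :: l)).
Proof.
  intros Ha Hsg Hl.
  change (talt_trunc ((a, sg) :: l)) with
    (psum (fun k => sg ^ k / od k ^ a * talt_trunc l (k - 1))).
  apply ex_lim_psum with 1; [lra|]. intros k Hk.
  unfold Rdiv at 2. rewrite Rmult_1_l.
  apply Rabs_talt_term; auto. apply Rabs_talt_trunc_le, Hl.
Qed.

(** [talt] is the real part of [Lim_seq], so a finite limit has to be established. The leading
    exponent is [s + 2 >= 3], or [s + 4] for a single part. *)
Lemma is_lim_seq_talt_t_args c : c <> [] ->
  List.Forall (fun a => (1 <= a)%nat) c ->
  is_lim_seq (talt_trunc (t_args c)) (talt (t_args c)).
Proof.
  intros Hc HF. apply Lim_seq_correct'.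
  rewrite t_args_bar_args by exact Hc.
  destruct HF as [|s c Hs HF]; [tauto|].
  assert (HA := bar_args_admissible c HF).
  destruct c as [|s' c].
  - apply ex_lim_talt_trunc; [lia | | constructor].
    rewrite Rabs_left; lra.
  - apply ex_lim_talt_trunc; [lia | apply Rabs_R1 | exact HA].
Qed.

Lemma is_lim_seq_csum n (u : list nat -> nat -> R) (l : list nat -> R) :
  (forall c, c <> [] -> List.Forall (fun a => (1 <= a)%nat) c ->
     is_lim_seq (u c) (l c)) ->
  is_lim_seq (fun N => csum n (fun c => u c N)) (csum n l).
Proof.
  intros H. unfold csum.
  apply (is_lim_seq_psum
    (fun N r => 2 ^ r * lsum (fun c => u c N) (compositions n r))
    (fun r => 2 ^ r * lsum l (compositions n r))).
  intros r Hr. apply is_lim_seq_mult'; [apply is_lim_seq_const|].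
  assert (HF : forall c, In c (compositions n r) -> is_lim_seq (u c) (l c)).
  { intros c Hc. apply compositions_spec in Hc as [Hl Hc].
    apply H; [|exact Hc]. intros ->. simpl in Hl. lia. }
  clear H. induction (compositions n r) as [|c cs IH]; unfold lsum in *; simpl.
  - apply is_lim_seq_const.
  - apply is_lim_seq_plus'; [apply HF; simpl; auto|].
    apply IH. intros; apply HF; simpl; auto.
Qed.

Theorem theorem4p7 (d : nat) :
  tstar ([2%nat] ++ repeat 1%nat d ++ [2%nat]) =
  - (2 / PI) *
    fold_right Rplus 0
      (map (fun r => 2 ^ r *
              fold_right Rplus 0
                (map (fun c => talt (t_args c)) (compositions (d + 1) r)))
           (List.seq 1 (d + 1))).
Proof.
  rewrite Nat.add_1_r.
  change (fold_right Rplus 0 _) with (csum (S d) (fun c => talt (t_args c))).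
  assert (H := is_lim_seq_csum (S d) (fun c => talt_trunc (t_args c))
                 (fun c => talt (t_args c)) is_lim_seq_talt_t_args).
  (* The series of [dual d k / od k ^ 3] now has the weighted sum of alternating t-values as its
     limit, which is the input for the star side. *)
  apply (is_lim_seq_ext _ _ _ (csum_talt_trunc d)) in H.
  apply is_lim_seq_tstar_trunc, is_lim_seq_unique in H.
  exact (f_equal real H).
Qed.
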